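(* Let $d\ge1$, $t\ge1$ be integers, $0\le s\le d$, and let $X_t\subseteq\mathbb S^d$ be $h_s$-measurable with $0<h_s(X_t)<\infty$, together with an integrable weight $w_t:X_t\to[0,\infty)$, such that the upper Marcinkiewicz–Zygmund inequality of order $t$ holds: \[ \frac1{h_s(X_t)}\int_{X_t}|f(x)|^2w_t(x)\,dh_s(x)\le A\|f\|_{L^2(\mathbb S^d)}^2\quad\text{for all }f\in\Pi_t . \] Suppose there exist a point $x_t\in X_t$ and parameters $\nu\in(0,1)$, $q>0$ such that, with $r>0$ defined by $r^2=(1-\nu)\frac{d+2}{t(t+d)}$, \[ \int_{X_t\cap B_r(x_t)}w_t(x)\,dh_s(x)\ge q\,r^s . \] Then \[ h_s(X_t)\ge c\,\frac{\dim\Pi_t}{t^s},\qquad c=\frac{q\,\nu^2}{A}\Big(\frac{1-\nu}{1+d/t}\,(d+2)\Big)^{s/2}. \]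
   Context: $\mathbb S^d\subset\mathbb R^{d+1}$ is the unit sphere with normalized surface measure (total mass $1$), and $L^2$ norms are with respect to it. $h_s$ denotes the $s$-dimensional Hausdorff measure (with respect to the geodesic or Euclidean metric on $\mathbb S^d$). $B_r(x)=\{y\in\mathbb S^d:x\cdot y\ge\cos r\}$. $\Pi_t$ is the space of restrictions to $\mathbb S^d$ of polynomials in $d+1$ variables of degree at most $t$, $\dim\Pi_t=\binom{d+t}{t}+\binom{d+t-1}{t-1}$. *)

(* Defs.v *)
From HB Require Import structures.
From mathcomp Require Import all_boot all_order all_algebra.
From mathcomp Require Import all_classical all_reals all_analysis.
Set Implicit Arguments. Unset Strict Implicit. Unset Printing Implicit Defensive.
Import Order.TTheory GRing.Theory Num.Theory.
Import numFieldNormedType.Exports.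
Local Open Scope classical_set_scope.
Local Open Scope ring_scope.

Section Defs.
Variables (R : realType) (d : nat).
Local Notation V := 'rV[R]_(d.+1).

Definition edot (x y : V) : R := \sum_(i < d.+1) x 0 i * y 0 i.
Definition enorm (x : V) : R := Num.sqrt (edot x x).

Definition sphere : set V := [set x | enorm x = 1].

Definition cap (x : V) (r : R) : set V := [set y | sphere y /\ cos r <= edot x y].

(* Euclidean diameter (extended real; -oo for the empty set) *)
Definition ediam (A : set V) : \bar R :=
  ereal_sup [set (enorm (x - y))%:E | x in A & y in A].

Definition diam_pow (s : R) (A : set V) : \bar R :=
  if A == set0 then 0%E else ((fine (ediam A)) `^ s)%:E.

Definition hausdorff_content (s delta : R) (A : set V) : \bar R :=
  ereal_inf [set (\sum_(0 <= i <oo) diam_pow s (F i))%E | F in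
     [set F : nat -> set V | A `<=` \bigcup_i F i /\
                            forall i, (ediam (F i) <= delta%:E)%E]].

(* s-dimensional Hausdorff (outer) measure, unnormalized *)
Definition hausdorff (s : R) (A : set V) : \bar R :=
  ereal_sup [set hausdorff_content s delta A | delta in [set delta : R | 0 < delta]].

Definition hmeas_type (s : R) := g_sigma_algebraType (hausdorff s).-caratheodory.

(* Pi_t : restrictions of real polynomials in d+1 variables of degree <= t *)
Definition is_poly_deg (t : nat) (f : V -> R) : Prop :=
  exists c : {ffun 'I_(d.+1) -> 'I_(t.+1)} -> R,
    forall x, sphere x ->
      f x = \sum_(a : {ffun 'I_(d.+1) -> 'I_(t.+1)} | (\sum_i (a i : nat) <= t)%N)
              c a * \prod_(i < d.+1) x 0 i ^+ a i.

End Defs.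

Definition dimPi (d t : nat) : nat := ('C(d + t, t) + 'C(d + t - 1, t - 1))%N.

(* Main.v *)
Require Import Defs.
From HB Require Import structures.
From mathcomp Require Import all_boot all_order all_algebra.
From mathcomp Require Import all_classical all_reals all_analysis.
From mathcomp Require Import measurable_realfun lra ring.
Import Order.TTheory GRing.Theory Num.Theory.
Import numFieldNormedType.Exports.
Local Open Scope classical_set_scope.
Local Open Scope ring_scope.

Set Implicit Arguments.
Unset Strict Implicit.
Unset Printing Implicit Defensive.

(** Test the inequality on the zonal polynomial f(x) = J((1 - x.x_t)/2), where
    J(z) = 2F1(-t, t + d; d/2 + 1; z) is the Jacobi polynomial with J(0) = 1.
    Its series is alternating with decreasing terms for z <= r^2/4, hence
    f >= nu on the cap B_r(x_t).  On the other side, f is a multiple of the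
    reproducing kernel of Pi_t, and its mean square is 1/dim Pi_t: this only
    depends on the moments of x.x_t, which are determined by invariance of the
    measure under reflections.  Indeed the mean of (x.v)^k depends only on |v|
    and k; comparing coefficients in v = e_0 + a e_j gives a recursion for the
    moments, and the moments of z = (1 - x.x_t)/2 are (d/2)_k/(d)_k.  The sums
    that remain are finite differences of polynomials.  If h_d of the sphere
    were 0 or infinite, then, as 0^-1 = 0 and fine +oo = 0, the right-hand side
    of the inequality would vanish, which is impossible. *)

(** * Jacobi polynomials and their moments *)

Section FiniteDifferences.
Variable R : realFieldType.
Implicit Types (x : R) (n k : nat) (p : {poly R}).

(** The Pochhammer symbol (x)_n = x (x + 1) ... (x + n - 1). *)
Definition rise x n : R := \prod_(i < n) (x + i%:R).

(** (x + X)_n as a polynomial in X; Pochhammer quotients in k become its values at k, so finite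
    differences apply to them. *)
Definition rise_poly x n : {poly R} := \prod_(i < n) ('X + (x + i%:R)%:P).

Lemma rise0 x : rise x 0 = 1. Proof. exact: big_ord0. Qed.

Lemma riseS x n : rise x n.+1 = rise x n * (x + n%:R).
Proof. by rewrite /rise big_ord_recr. Qed.

Lemma rise1 x : rise x 1 = x.
Proof. by rewrite riseS rise0 mul1r addr0. Qed.

Lemma riseSl x n : rise x n.+1 = x * rise (x + 1) n.
Proof.
rewrite /rise big_ord_recl addr0; congr (_ * _); apply: eq_bigr => i _.
by rewrite -addrA -natr1 [i%:R + 1]addrC.
Qed.

Lemma riseD x m n : rise x (m + n) = rise x m * rise (x + m%:R) n.
Proof.
elim: n => [|n IH]; first by rewrite addn0 rise0 mulr1.
by rewrite addnS !riseS IH natrD addrA mulrA.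
Qed.

Lemma rise_gt0 x n : 0 < x -> 0 < rise x n.
Proof. by move=> x0; apply: prodr_gt0 => i _; rewrite ltr_wpDr. Qed.

Lemma rise_polyE x n y : (rise_poly x n).[y] = rise (x + y) n.
Proof.
rewrite horner_prod; apply: eq_bigr => i _.
by rewrite hornerD hornerX hornerC; ring.
Qed.

Lemma size_rise_poly x n : size (rise_poly x n) = n.+1.
Proof.
have -> : rise_poly x n = \prod_(i < n) ('X - (- (x + i%:R))%:P).
  by apply: eq_bigr => i _; rewrite polyCN opprK.
by rewrite size_prod_XsubC /index_enum -enumT size_enum_ord.
Qed.

(** With E the shift, this is (1 - E)^(n+1) = (1 - E)^n (1 - E) applied to f at 0; it follows from
    Pascal's rule. *)
Lemma alternating_binS (f : nat -> R) n :
  \sum_(k < n.+2) (-1) ^+ k * 'C(n.+1, k)%:R * f k =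
  \sum_(k < n.+1) (-1) ^+ k * 'C(n, k)%:R * (f k - f k.+1).
Proof.
rewrite big_ord_recl /= bin0.
under eq_bigr do rewrite /bump /= add1n binS natrD mulrDr mulrDl.
rewrite big_split /= big_ord_recr /= bin_small// mulr0 mul0r addr0.
rewrite addrA -[X in (_ + X) + _]/(\sum_(i < n) _).
under [RHS]eq_bigr do rewrite mulrBr.
rewrite sumrB [in RHS]big_ord_recl /= bin0; congr (_ + _ + _).
rewrite -sumrN; apply: eq_bigr => i _; rewrite exprS; ring.
Qed.

(** p(X) and p(X + 1) have the same leading coefficient, so the difference loses a degree. *)
Lemma size_sub_shift p n : (size p <= n.+1)%N ->
  (size (p - (p \Po ('X + 1%:P)))%R <= n)%N.
Proof.
move=> sp; have sX : size ('X + 1%:P : {poly R}) = 2%N by rewrite size_XaddC.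
apply/leq_sizeP => j; rewrite leq_eqVlt coefB => /predU1P[<-{j}|nj].
  move: sp; rewrite leq_eqVlt => /predU1P[sp|sp]; last first.
    by rewrite !nth_default ?subrr ?size_comp_poly2// -ltnS.
  have -> : p`_n = lead_coef p by rewrite lead_coefE sp.
  have -> : (p \Po ('X + 1%:P))`_n = lead_coef (p \Po ('X + 1%:P)).
    by rewrite lead_coefE size_comp_poly2// sp.
  rewrite lead_coef_comp ?sX// lead_coefDl ?size_polyX ?size_polyC ?oner_neq0//.
  by rewrite lead_coefX expr1n mulr1 subrr.
by rewrite !nth_default ?subrr ?size_comp_poly2//; exact: leq_trans nj.
Qed.

Lemma alternating_bin_poly n p : (size p <= n)%N ->
  \sum_(k < n.+1) (-1) ^+ k * 'C(n, k)%:R * p.[k%:R] = 0.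
Proof.
elim: n p => [|n IH] p sp.
  move: sp; rewrite leqn0 size_poly_eq0 => /eqP ->.
  by rewrite big1// => *; rewrite horner0 mulr0.
rewrite (alternating_binS (fun k => p.[k%:R])) -[RHS](IH _ (size_sub_shift sp)).
by apply: eq_bigr => k _; rewrite !hornerE horner_comp !hornerE natr1.
Qed.

(** The partial fraction expansion of n!/(x)_(n+1). Differencing 1/(x + k) in k leads to the
    induction hypotheses at x and x + 1. *)
Lemma alternating_bin_inv n x : 0 < x ->
  \sum_(k < n.+1) (-1) ^+ k * 'C(n, k)%:R * (x + k%:R)^-1 = n`!%:R / rise x n.+1.
Proof.
elim: n x => [|n IH] x x0.
  by rewrite big_ord1 bin0 !mul1r riseS rise0 addr0 mul1r.
rewrite (alternating_binS (fun k => (x + k%:R)^-1)).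
under eq_bigr do rewrite mulrBr -natr1 [_ + 1]addrC addrA.
rewrite sumrB !IH ?ltr_wpDr// [rise x n.+2]riseSl factS natrM.
rewrite [rise x n.+1]riseSl [rise (x + 1) n.+1]riseS.
have := rise_gt0 n (ltr_wpDr ler01 x0).
move: (rise (x + 1) n) => y y0.
have n0 : 0 <= n%:R :> R by [].
rewrite -[n.+1%:R]natr1; field; rewrite ?gt_eqF//; lra.
Qed.

End FiniteDifferences.

(** * Partial sums of alternating series with decreasing terms *)

Section AlternatingSums.
Variable R : realFieldType.

(** Without its first term, the sum is minus the sum of the shifted sequence, which lies in [0, b 1]
    by induction. *)
Lemma alternating_sum_bound (b : nat -> R) n :
  (forall k, 0 <= b k) -> (forall k, b k.+1 <= b k) ->
  0 <= \sum_(k < n) (-1) ^+ k * b k <= b 0%N.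
Proof.
elim: n b => [|n IH] b b0 bS; first by rewrite big_ord0 lexx b0.
rewrite big_ord_recl expr0 mul1r.
have -> : \sum_(i < n) (-1) ^+ lift ord0 i * b (lift ord0 i) =
    - \sum_(i < n) (-1) ^+ i * b i.+1.
  by rewrite -sumrN; apply: eq_bigr => i _; rewrite /= /bump add1n exprS; ring.
have /andP[] := IH (fun k => b k.+1) (fun k => b0 _) (fun k => bS _).
by have := bS 0%N; lra.
Qed.

Lemma alternating_sum_ge (b : nat -> R) n :
  (forall k, 0 <= b k) -> (forall k, b k.+1 <= b k) ->
  b 0%N - b 1%N <= \sum_(k < n.+1) (-1) ^+ k * b k.
Proof.
move=> b0 bS; rewrite big_ord_recl expr0 mul1r.
have -> : \sum_(i < n) (-1) ^+ lift ord0 i * b (lift ord0 i) =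
    - \sum_(i < n) (-1) ^+ i * b i.+1.
  by rewrite -sumrN; apply: eq_bigr => i _; rewrite /= /bump add1n exprS; ring.
have /andP[] := alternating_sum_bound n (fun k => b0 k.+1) (fun k => bS _).
lra.
Qed.

End AlternatingSums.

(** * The Jacobi polynomial and its reproducing property *)

Section JacobiKernel.
Variables (R : realFieldType) (d t : nat).
Hypotheses (d0 : (0 < d)%N) (t0 : (0 < t)%N).
Let h : R := d%:R / 2.
Let c : R := d%:R / 2 + 1.

Let dR0 : 0 < d%:R :> R. Proof. by rewrite ltr0n. Qed.
Let h0 : 0 < h. Proof. by rewrite divr_gt0. Qed.
Let c0 : 0 < c. Proof. by rewrite ltr_wpDl// ltW. Qed.

(* Coefficients, in powers of [(1 - u) / 2], of the Jacobi polynomial with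
   parameters (d/2, d/2 - 1), i.e. of the Gauss series 2F1(-t, t + d; d/2 + 1; .). *)
Definition jacobi_abs_coef k : R :=
  'C(t, k)%:R * rise (t%:R + d%:R) k / rise (d%:R / 2 + 1) k.

Definition jacobi_coef k : R := (-1) ^+ k * jacobi_abs_coef k.

Lemma jacobi_abs_coef_ge0 k : 0 <= jacobi_abs_coef k.
Proof.
rewrite !mulr_ge0 ?invr_ge0 ?ler0n// ltW// rise_gt0//.
by rewrite ltr_wpDl.
Qed.

Lemma jacobi_coef0 : jacobi_coef 0 = 1.
Proof. by rewrite /jacobi_coef /jacobi_abs_coef bin0 !rise0 divr1 !mul1r. Qed.

(** For k <= t the ratio of the two terms is (t - k)(t + d + k) z / ((k + 1)(c + k)). Since (t -
    k)(t + d + k) = t(t + d) - k(k + d), it is at most z t(t + d)/c <= 1. For k > t the binomial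
    vanishes. *)
Lemma jacobi_abs_coef_decr k (z : R) : 0 <= z ->
  z * (t%:R * (t%:R + d%:R)) <= c ->
  jacobi_abs_coef k.+1 * z ^+ k.+1 <= jacobi_abs_coef k * z ^+ k.
Proof.
move=> z0 zc; have [kt|kt] := leqP k t; last first.
  have -> : jacobi_abs_coef k.+1 = 0.
    by rewrite /jacobi_abs_coef bin_small ?mul0r// leqW.
  by rewrite mul0r mulr_ge0 ?exprn_ge0// jacobi_abs_coef_ge0.
have k0 : 0 <= k%:R :> R by [].
have ktR : k%:R <= t%:R :> R by rewrite ler_nat.
have binE : 'C(t, k.+1)%:R = 'C(t, k)%:R * (t%:R - k%:R) / k.+1%:R :> R.
  apply: (@mulIf _ k.+1%:R); first by rewrite pnatr_eq0.
  by rewrite divfK ?pnatr_eq0// -natrB// -!natrM mulnC mul_bin_left mulnC.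
have ck : 0 < c + k%:R by rewrite ltr_wpDr.
have -> : jacobi_abs_coef k.+1 * z ^+ k.+1 = jacobi_abs_coef k * z ^+ k *
    (((t%:R - k%:R) * (t%:R + d%:R + k%:R) * z) / (k.+1%:R * (c + k%:R))).
  rewrite /jacobi_abs_coef binE !riseS exprS -/c.
  have := rise_gt0 k c0; move: (rise c k) => y y0.
  by field; rewrite ?pnatr_eq0 !gt_eqF.
apply: ler_piMr; first by rewrite mulr_ge0 ?exprn_ge0// jacobi_abs_coef_ge0.
rewrite ler_pdivrMr ?mulr_gt0// mul1r.
apply: le_trans (_ : c <= _); last first.
  rewrite -[k.+1%:R]natr1; have := c0; nra.
apply: le_trans zc; rewrite mulrC; apply: ler_wpM2l => //.
have := dR0; nra.
Qed.

Lemma jacobi_ge (z : R) : 0 <= z -> z * (t%:R * (t%:R + d%:R)) <= c ->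
  1 - z * (t%:R * (t%:R + d%:R)) / c <= \sum_(k < t.+1) jacobi_coef k * z ^+ k.
Proof.
move=> z0 zc; pose b k := jacobi_abs_coef k * z ^+ k.
have := alternating_sum_ge t (b := b).
have -> : \sum_(k < t.+1) (-1) ^+ k * b k = \sum_(k < t.+1) jacobi_coef k * z ^+ k.
  by apply: eq_bigr => k _; rewrite mulrA.
have -> : b 0%N = 1 by rewrite /b /jacobi_abs_coef bin0 !rise0 expr0 divr1 !mulr1.
have -> : b 1%N = z * (t%:R * (t%:R + d%:R)) / c.
  by rewrite /b /jacobi_abs_coef bin1 !rise1 expr1 mulrC !mulrA.
apply=> k; first by rewrite mulr_ge0 ?exprn_ge0// jacobi_abs_coef_ge0.
exact: jacobi_abs_coef_decr.
Qed.

(** The closed form dim Pi_t = (d)_t (d + 2t) / (d t!), cleared of denominators. *)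
Lemma dimPi_fact :
  (dimPi d t)%:R * (d%:R / 2 * t`!%:R) = rise d%:R t * (d%:R / 2 + t%:R) :> R.
Proof.
have [n dE] : exists n, d = n.+1 by exists d.-1; rewrite prednK.
have [u tE] : exists u, t = u.+1 by exists t.-1; rewrite prednK.
have nF : n`!%:R != 0 :> R by rewrite pnatr_eq0 -lt0n fact_gt0.
(* Since d = n + 1, multiplying by n! turns (d)_t into a factorial; the binomials then enter only
   through [bin_fact]. *)
have riseE m : rise n.+1%:R m * n`!%:R = (n + m)`!%:R :> R.
  elim: m => [|m IH]; first by rewrite rise0 mul1r addn0.
  by rewrite riseS mulrAC IH addnS factS natrM -natrD mulrC addSn.
apply: (mulIf nF); rewrite dE tE [RHS]mulrAC riseE.
have dimE : (dimPi n.+1 u.+1)%:R =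
    'C(n.+1 + u.+1, u.+1)%:R + 'C(n.+1 + u, u)%:R :> R.
  by rewrite -natrD /dimPi addnS !subSS !subn0.
have := congr1 (fun k => k%:R : R) (bin_fact (leq_addl n.+1 u.+1)).
have := congr1 (fun k => k%:R : R) (bin_fact (leq_addl n.+1 u)).
rewrite !addnK dimE; move: 'C(_, u) 'C(_, u.+1) => x y.
rewrite addSnnS addSn [(n + u.+1).+1`!]factS [u.+1`!]factS [n.+1`!]factS !natrM.
rewrite -[(n + u.+1).+1%:R]natr1 natrD -[u.+1%:R]natr1 -[n.+1%:R]natr1.
move: x%:R y%:R => {}x {}y.
move: (n`!%:R : R) (u`!%:R : R) ((n + u.+1)`!%:R : R) => a b e Hx Hy.
transitivity ((y * ((u%:R + 1) * b * ((n%:R + 1) * a)) +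
  (u%:R + 1) * (x * (b * ((n%:R + 1) * a)))) / 2); first by field.
by rewrite Hx Hy; field.
Qed.

Section Moments.
Variable mu : nat -> R.
Hypotheses (mu0 : mu 0%N = 1)
  (muS : forall k, (d%:R / 2 + k%:R) * mu k = (d%:R + k%:R) * mu k.+1).

(** The first-order recursion [muS] determines mu: these are the moments of the Beta(d/2, d/2)
    law. *)
Lemma momentE k : mu k = rise (d%:R / 2) k / rise d%:R k.
Proof.
elim: k => [|k IH]; first by rewrite !rise0 divr1.
have dk : 0 < d%:R + k%:R :> R by rewrite ltr_wpDr.
have -> : mu k.+1 = (d%:R / 2 + k%:R) * mu k / (d%:R + k%:R).
  by rewrite muS mulrC mulKf// gt_eqF.
rewrite IH !riseS; have := rise_gt0 k dR0; move: (rise d%:R k) => y y0.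
by field; rewrite !gt_eqF.
Qed.

(* In both moment sums the Pochhammer quotients collapse to polynomials in k,
   up to the factor 1/(d/2 + k) in the first one. *)
Lemma jacobi_moment0 : \sum_(k < t.+1) jacobi_coef k * mu k = (dimPi d t)%:R^-1.
Proof.
(* Each term is a constant times (-1)^k C(t, k) Q(k)/(h + k). Write Q = q (X + h) + Q(-h): the
   quotient q has degree below t and is killed by the t-th difference, and Q(-h) = (h)_t multiplies
   the sum of [alternating_bin_inv]. *)
pose Q := rise_poly (d%:R : R) t.
have /factor_theorem[q qE] : root (Q - (Q.[- h])%:P) (- h).
  by rewrite /root !hornerE subrr.
have sq : (size q <= t)%N.
  have [->|q0] := eqVneq q 0; first by rewrite size_poly0.
  have : (size (q * ('X - (- h)%:P))%R <= t.+1)%N.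
    rewrite -qE (leq_trans (size_polyD _ _))// size_polyN geq_max size_rise_poly leqnn.
    by rewrite (leq_trans (size_polyC_leq1 _)).
  by rewrite size_Mmonic ?monicXsubC// size_XsubC addn2.
have hk k : 0 < h + k%:R by rewrite ltr_wpDr.
have QE k : Q.[k%:R] / (h + k%:R) = q.[k%:R] + rise h t / (h + k%:R).
  have := congr1 (horner^~ k%:R) qE; rewrite !hornerE opprK => /eqP.
  rewrite subr_eq => /eqP ->; rewrite [k%:R + h]addrC mulrDl mulfK ?gt_eqF//.
  by rewrite rise_polyE; congr (_ + rise _ _ / _); rewrite /h; field.
have termE (k : nat) : jacobi_coef k * mu k = h / rise d%:R t *
    ((-1) ^+ k * 'C(t, k)%:R * (Q.[k%:R] / (h + k%:R))).
  rewrite rise_polyE momentE /jacobi_coef /jacobi_abs_coef -/h -/c.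
  (* As c = h + 1, E1 says (h)_k / (c)_k = h/(h + k). E2 computes (d)_(k+t) in two ways to exchange
     (t + d)_k / (d)_k for (d + k)_t / (d)_t. *)
  have E1 : rise h k = h * rise c k / (h + k%:R).
    by rewrite -riseSl riseS mulfK// gt_eqF.
  have E2 : rise (d%:R + k%:R) t = rise d%:R t * rise (t%:R + d%:R) k / rise d%:R k :> R.
    by rewrite [t%:R + _]addrC -riseD addnC riseD mulrAC mulfV ?mul1r// gt_eqF// rise_gt0.
  rewrite E1 E2; have := rise_gt0 k c0; have := rise_gt0 k dR0.
  have := rise_gt0 t dR0; have := hk k.
  move: (rise c k) (rise d%:R k) (rise d%:R t) => x y w *.
  by field; rewrite !gt_eqF.
rewrite (eq_bigr _ (fun k : 'I_t.+1 => fun=> termE k)) -mulr_sumr.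
under eq_bigr do rewrite QE mulrDr.
rewrite big_split /= alternating_bin_poly// add0r.
have -> : \sum_(i < t.+1) (-1) ^+ i * 'C(t, i)%:R * (rise h t / (h + i%:R)) =
    rise h t * (t`!%:R / rise h t.+1).
  by rewrite -alternating_bin_inv// mulr_sumr; apply: eq_bigr => i _; ring.
have dimE := dimPi_fact.
have dim0 : (dimPi d t)%:R != 0 :> R.
  by rewrite pnatr_eq0 -lt0n addn_gt0 bin_gt0 leq_addl.
apply: (mulfI dim0); rewrite mulfV// riseS.
have := rise_gt0 t h0; have := rise_gt0 t dR0; have := hk t.
move: (rise h t) (rise d%:R t) dimE => x y dimE *.
transitivity ((dimPi d t)%:R * (h * t`!%:R) / (y * (h + t%:R))).
  by field; rewrite !gt_eqF.
by rewrite dimE mulfV// mulf_neq0// gt_eqF.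
Qed.

(** With [jacobi_moment0], this is the reproducing property: pairing z^j with the Jacobi polynomial
    gives the value of z^j at z = 0, divided by dim Pi_t. *)
Lemma jacobi_moment_eq0 j : (0 < j <= t)%N ->
  \sum_(k < t.+1) jacobi_coef k * mu (k + j)%N = 0.
Proof.
case: j => // j /= jt.
(* The exponent is now j + 1, so P has degree j + (t - j - 1) = t - 1, just below the order of the
   difference. *)
pose P := rise_poly c j * rise_poly (d%:R + j.+1%:R) (t - j.+1).
have sP : (size P <= t)%N.
  by rewrite (leq_trans (size_polyMleq _ _))// !size_rise_poly addnS /= subnKC.
have termE (k : nat) : jacobi_coef k * mu (k + j.+1)%N = h / rise d%:R t *
    ((-1) ^+ k * 'C(t, k)%:R * P.[k%:R]).
  rewrite hornerM !rise_polyE momentE /jacobi_coef /jacobi_abs_coef -/h -/c.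
  rewrite addnS riseSl -/c riseD -addnS.
  have E2 : rise (d%:R + j.+1%:R + k%:R) (t - j.+1) =
      rise d%:R t * rise (t%:R + d%:R) k / rise d%:R (k + j.+1) :> R.
    rewrite [t%:R + _]addrC -riseD addnC -[in (k + t)%N](subnKC jt) addnA riseD.
    by rewrite natrD -addrA [j.+1%:R + _]addrC mulrAC mulfV ?mul1r// gt_eqF// rise_gt0.
  rewrite E2; have := rise_gt0 k c0; have := rise_gt0 (k + j.+1) dR0.
  have := rise_gt0 t dR0.
  move: (rise c k) (rise d%:R (k + j.+1)) (rise d%:R t) => x y w *.
  by field; rewrite !gt_eqF.
rewrite (eq_bigr _ (fun k : 'I_t.+1 => fun=> termE k)) -mulr_sumr.
by rewrite alternating_bin_poly ?mulr0.
Qed.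

End Moments.

(** The variable z = (1 - u)/2; for u = x.y with x, y on the sphere it is |x - y|^2 / 4. *)
Definition half_gap : {poly R} := 2^-1 *: (1 - 'X).

Definition jacobi : {poly R} := \sum_(k < t.+1) jacobi_coef k *: half_gap ^+ k.

Lemma size_jacobi : (size jacobi <= t.+1)%N.
Proof.
apply: (leq_trans (size_sum _ _ _)); apply/bigmax_leqP => k _.
apply: (leq_trans (size_scale_leq _ _)).
have s2 : (size half_gap <= 2)%N.
  rewrite (leq_trans (size_scale_leq _ _))// (leq_trans (size_polyD _ _))//.
  by rewrite size_polyN size_polyX size_poly1.
apply: (leq_trans (size_poly_exp_leq _ _)); rewrite ltnS.
apply: leq_trans (_ : 1 * k <= t)%N; last by rewrite mul1n -ltnS.
by rewrite leq_mul2r; apply/orP; right; case: (size _) s2 => // -[|[]].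
Qed.

Lemma horner_jacobi u :
  jacobi.[u] = \sum_(k < t.+1) jacobi_coef k * ((1 - u) / 2) ^+ k.
Proof.
rewrite horner_sum; apply: eq_bigr => k _.
by rewrite hornerZ horner_exp /half_gap hornerZ !hornerE mulrC [2^-1 * _]mulrC mulrC.
Qed.

Section Functional.
(** L stands for the map sending p to the mean of p(x.v) over the sphere; [LXn] is the moment
    recursion obtained from reflections. *)
Variable L : {poly R} -> R.
Hypotheses (LD : forall p q, L (p + q) = L p + L q)
  (LZ : forall a p, L (a *: p) = a * L p)
  (L1 : L 1 = 1) (LX : L 'X = 0)
  (LXn : forall k, k.+1%:R * (L 'X^k - L 'X^(k.+2)) = d%:R * L 'X^(k.+2)).

Let L0 : L 0 = 0. Proof. by rewrite -(scale0r 0) LZ mul0r. Qed.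

Let LN p : L (- p) = - L p. Proof. by rewrite -scaleN1r LZ mulN1r. Qed.

Let Lsum n (F : 'I_n -> {poly R}) : L (\sum_(i < n) F i) = \sum_(i < n) L (F i).
Proof. exact: (big_morph L LD L0). Qed.

(** For the weight (1 - u^2)^(d/2 - 1) this is integration by parts. On monomials it is [LXn], or
    [LX] for constants, and it extends by linearity. *)
Lemma functional_by_parts p : L ((1 - 'X^2) * p^`()) = d%:R * L ('X * p).
Proof.
rewrite -[p]coefK poly_def raddf_sum /= !mulr_sumr !Lsum mulr_sumr.
apply: eq_bigr => -[[|i] _] _ /=.
  by rewrite derivZ derivC scaler0 mulr0 L0 -scalerAr mulr1 LZ LX !mulr0.
rewrite derivZ derivXn /= -!scalerAr !LZ mulrCA -LXn; congr (_ * _).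
by rewrite mulrnAr -scaler_nat LZ mulrBl mul1r -exprD LD LN.
Qed.

(** Apply [functional_by_parts] to z^k, using 1 - u^2 = 4 z (1 - z), z' = -1/2 and u = 1 - 2z. *)
Lemma functional_half_gapS k :
  (d%:R / 2 + k%:R) * L (half_gap ^+ k) = (d%:R + k%:R) * L (half_gap ^+ k.+1).
Proof.
have XE : 'X = 1 - 2 * half_gap.
  rewrite /half_gap -mul_polyC mulrA -[2 : {poly R}]polyC_natr -polyCM.
  by rewrite divff ?pnatr_eq0// polyC1 mul1r subKr.
have dE : 4 * half_gap^`() = - 2.
  rewrite derivZ derivB derivC derivX sub0r scalerN -mul_polyC mulr1 mulrN.
  rewrite -[4]polyC_natr -polyCM -polyC_natr; congr (- _%:P); lra.
have polyCE a n : (a * n%:R)%:P = a%:P * n%:R :> {poly R} by rewrite polyCM polyC_natr.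
have E1 : (1 - 'X^2) * (half_gap ^+ k)^`() =
    (- 2 * k%:R) *: half_gap ^+ k + (2 * k%:R) *: half_gap ^+ k.+1.
  case: k => [|k]; first by rewrite derivC mulr0 !mulr0 !scale0r addr0.
  rewrite deriv_exp -mulr_natr -!mul_polyC !polyCE polyCN polyC_natr /=.
  transitivity ((4 * half_gap^`()) * half_gap ^+ k.+1 * (1 - half_gap) * k.+1%:R).
    by rewrite XE !exprS; ring.
  by rewrite dE !exprS; ring.
have E2 : 'X * half_gap ^+ k = half_gap ^+ k + (- 2) *: half_gap ^+ k.+1.
  by rewrite -mul_polyC polyCN polyC_natr {1}XE exprS; ring.
have := functional_by_parts (half_gap ^+ k).
by rewrite E1 E2 !LD !LZ; lra.
Qed.

(** Expand one factor in powers of z: by orthogonality only the constant term, with coefficient 1,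
    contributes. *)
Lemma functional_jacobi_sqr : L (jacobi ^+ 2) = (dimPi d t)%:R^-1.
Proof.
have muS := functional_half_gapS.
have mu0 : L (half_gap ^+ 0) = 1 by [].
rewrite expr2 {1}/jacobi mulr_suml Lsum.
have E j : (j <= t)%N -> L (half_gap ^+ j * jacobi) =
    \sum_(k < t.+1) jacobi_coef k * L (half_gap ^+ (k + j)%N).
  move=> jt; rewrite mulr_sumr Lsum; apply: eq_bigr => k _.
  by rewrite -scalerAr -exprD LZ addnC.
rewrite big_ord_recl big1 => [|j _].
  rewrite jacobi_coef0 scale1r E// addr0 -(jacobi_moment0 mu0 muS).
  by apply: eq_bigr => k _; rewrite addn0.
have jt : (0 < lift ord0 j <= t)%N by rewrite lift0 /=.
rewrite -scalerAl LZ (E _ (andP jt).2).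
by have := jacobi_moment_eq0 mu0 muS jt => /= ->; rewrite mulr0.
Qed.

End Functional.

End JacobiKernel.

(** * Hausdorff measure as a metric outer measure *)

Section HausdorffOuterMeasure.
Variables (R : realType) (d : nat).
Local Notation V := 'rV[R]_(d.+1).
Implicit Types (A B X : set V) (s delta : R).
Local Open Scope ereal_scope.

Lemma diam_pow_ge0 s A : 0 <= diam_pow s A.
Proof. by rewrite /diam_pow; case: ifP => // _; rewrite lee_fin powR_ge0. Qed.

Lemma diam_pow0 s : diam_pow s (set0 : set V) = 0.
Proof. by rewrite /diam_pow eqxx. Qed.

Lemma ediam0 : ediam (set0 : set V) = -oo.
Proof.
rewrite /ediam [X in ereal_sup X](_ : _ = set0) ?ereal_sup0//.
by apply/seteqP; split => // x [y].
Qed.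

(* The weight whose induced outer measure [mu_ext] is the content at scale delta. *)
Definition small_diam_pow s delta A : \bar R :=
  if ediam A <= delta%:E then diam_pow s A else +oo.

Lemma small_diam_pow_ge0 s delta A : 0 <= small_diam_pow s delta A.
Proof. by rewrite /small_diam_pow; case: ifP => // _; exact: diam_pow_ge0. Qed.

Lemma small_diam_pow0 s delta : small_diam_pow s delta set0 = 0.
Proof. by rewrite /small_diam_pow ediam0 leNye diam_pow0. Qed.

(** Covers with a piece of diameter above delta cost +oo and do not affect the infimum. The content
    thus inherits countable subadditivity from [mu_ext]. *)
Lemma hausdorff_contentE s delta A : hausdorff_content s delta A =
  @mu_ext _ (g_sigma_algebraType [set: set V]) R (small_diam_pow s delta) A.
Proof.
(* [mu_ext] takes covers by measurable sets; for this sigma-algebra every set is measurable. *)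
have mT (B : set V) : @measurable _ (g_sigma_algebraType [set: set V]) B.
  exact: sub_sigma_algebra.
apply/eqP; rewrite eq_le; apply/andP; split.
  apply: le_ereal_inf_tmp => _ [F [_ AF] <-].
  have [sF|] := pselect (forall i, ediam (F i) <= delta%:E).
    apply: ereal_inf_lbound; exists F => //.
    by apply: eq_eseriesr => i _; rewrite /small_diam_pow sF.
  move=> /existsNP[i /negP sFi].
  rewrite (@eseries_pinfty _ _ _ i) ?leey//.
    by move=> n _; rewrite -ltNye (lt_le_trans _ (small_diam_pow_ge0 _ _ _)).
  by rewrite /small_diam_pow (negbTE sFi).
apply: le_ereal_inf_tmp => _ [F [AF sF] <-].
apply: ereal_inf_lbound; exists F => //.
by apply: eq_eseriesr => i _; rewrite /small_diam_pow sF.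
Qed.

Lemma hausdorff_content_ge0 s delta A : 0 <= hausdorff_content s delta A.
Proof. by rewrite hausdorff_contentE; exact/mu_ext_ge0/small_diam_pow_ge0. Qed.

Lemma le_hausdorff_content s delta A B : A `<=` B ->
  hausdorff_content s delta A <= hausdorff_content s delta B.
Proof. by move=> AB; rewrite !hausdorff_contentE; exact: le_mu_ext. Qed.

Lemma hausdorff_content_antimono s (d1 d2 : R) A : (d1 <= d2)%R ->
  hausdorff_content s d2 A <= hausdorff_content s d1 A.
Proof.
move=> d12; apply: ereal_inf_le_tmp => _ [F [AF sF] <-]; exists F => //.
by split=> // i; rewrite (le_trans (sF i))// lee_fin.
Qed.

Lemma hausdorff_content_le s delta A : (0 < delta)%R ->
  hausdorff_content s delta A <= hausdorff s A.
Proof. by move=> d0; apply: ereal_sup_ubound; exists delta. Qed.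

Lemma hausdorff_leP s A (y : \bar R) :
  (forall delta, (0 < delta)%R -> hausdorff_content s delta A <= y) ->
  hausdorff s A <= y.
Proof. by move=> H; apply: ge_ereal_sup => _ [delta /= d0 <-]; exact: H. Qed.

Lemma hausdorff_ge0 s A : 0 <= hausdorff s A.
Proof.
apply: (le_trans (hausdorff_content_ge0 s 1 A)); exact: hausdorff_content_le.
Qed.

Lemma hausdorff0 s : hausdorff s (set0 : set V) = 0.
Proof.
apply/eqP; rewrite eq_le hausdorff_ge0 andbT; apply: hausdorff_leP => delta _.
rewrite hausdorff_contentE mu_ext0//; [exact: small_diam_pow0|].
exact: small_diam_pow_ge0.
Qed.

Lemma le_hausdorff s A B : A `<=` B -> hausdorff s A <= hausdorff s B.
Proof.
move=> AB; apply: hausdorff_leP => delta d0.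
exact: le_trans (le_hausdorff_content _ _ AB) (hausdorff_content_le _ _ d0).
Qed.

Lemma hausdorff_sigma_subadditive s : sigma_subadditive (@hausdorff R d s).
Proof.
move=> F; apply: hausdorff_leP => delta d0.
rewrite hausdorff_contentE.
apply: (le_trans (mu_ext_sigma_subadditive _ _)); first exact: small_diam_pow_ge0.
apply: lee_nneseries => [i _ _|i _]; first exact/mu_ext_ge0/small_diam_pow_ge0.
by rewrite -hausdorff_contentE; exact: hausdorff_content_le.
Qed.

HB.instance Definition _ s := isOuterMeasure.Build R V (@hausdorff R d s)
  (hausdorff0 s) (hausdorff_ge0 s) (@le_hausdorff s)
  (hausdorff_sigma_subadditive s).

Lemma le_ediam A x y : A x -> A y -> (enorm (x - y))%:E <= ediam A.
Proof. by move=> Ax Ay; apply: ereal_sup_ubound; exists x => //; exists y. Qed.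

(** Positive distance between sets is expressed by a gap between the values of such a function. *)
Definition lipschitz1 (g : V -> R) :=
  forall x y, (`|g x - g y| <= enorm (x - y))%R.

(** A piece of diameter at most delta cannot meet both A and B, so a cover of the union splits: G
    keeps the pieces meeting A, H the others, and the empty fillers cost 0. *)
Lemma hausdorff_content_separated s delta (g : V -> R) (a b : R) A B :
  lipschitz1 g -> (delta < b - a)%R ->
  (forall x, A x -> g x <= a)%R -> (forall x, B x -> b <= g x)%R ->
  hausdorff_content s delta A + hausdorff_content s delta B
    <= hausdorff_content s delta (A `|` B).
Proof.
move=> lg dab Aa Bb; apply: le_ereal_inf_tmp => _ [F [ABF sF] <-].
pose G i := if pselect (exists x, A x /\ F i x) then F i else set0.
pose H i := if pselect (exists x, A x /\ F i x) then set0 else F i.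
have AG : A `<=` \bigcup_i G i.
  move=> x Ax; have [i _ Fix] := ABF x (or_introl Ax).
  by exists i => //; rewrite /G; case: pselect => // -[]; exists x.
have BH : B `<=` \bigcup_i H i.
  move=> y By; have [i _ Fiy] := ABF y (or_intror By).
  exists i => //; rewrite /H; case: pselect => // -[x [Ax Fix]].
  have := le_trans (le_ediam Fiy Fix) (sF i); rewrite lee_fin => yxd.
  have := lg y x; have := Aa _ Ax; have := Bb _ By.
  have := ler_norm (g y - g x)%R; lra.
have dG i : ediam (G i) <= delta%:E.
  by rewrite /G; case: pselect => ?; rewrite ?ediam0 ?leNye ?sF.
have dH i : ediam (H i) <= delta%:E.
  by rewrite /H; case: pselect => ?; rewrite ?ediam0 ?leNye ?sF.
rewrite (_ : \sum_(0 <= i <oo) diam_pow s (F i) =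
  \sum_(0 <= i <oo) diam_pow s (G i) + \sum_(0 <= i <oo) diam_pow s (H i)).
  by apply: leeD; apply: ereal_inf_lbound; [exists G|exists H].
rewrite -nneseriesD; last 2 first.
- by move=> i _ _; exact: diam_pow_ge0.
- by move=> i _ _; exact: diam_pow_ge0.
apply: eq_eseriesr => i _; rewrite /G /H.
by case: pselect => ?; rewrite diam_pow0 ?adde0 ?add0e.
Qed.

Lemma hausdorff_separated s (g : V -> R) (a b : R) A B :
  lipschitz1 g -> (a < b)%R ->
  (forall x, A x -> g x <= a)%R -> (forall x, B x -> b <= g x)%R ->
  hausdorff s A + hausdorff s B <= hausdorff s (A `|` B).
Proof.
move=> lg ab Aa Bb.
have [->|] := eqVneq (hausdorff s (A `|` B)) +oo; first by rewrite leey.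
rewrite -ltey => fAB.
have fin C : C `<=` A `|` B -> hausdorff s C \is a fin_num.
  move=> CAB; rewrite ge0_fin_numE ?hausdorff_ge0//.
  exact: le_lt_trans (le_hausdorff _ CAB) fAB.
have finc delta C : (0 < delta)%R -> C `<=` A `|` B ->
    hausdorff_content s delta C \is a fin_num.
  move=> d0 CAB; rewrite ge0_fin_numE ?hausdorff_content_ge0//.
  rewrite (le_lt_trans (hausdorff_content_le _ _ d0))//.
  exact: le_lt_trans (le_hausdorff _ CAB) fAB.
rewrite -leeBrDl; last exact/fin/subsetUl.
apply: hausdorff_leP => d1 d10.
rewrite leeBrDl; last exact/fin/subsetUl.
rewrite -leeBrDr; last exact/finc/subsetUr.
apply: hausdorff_leP => d2 d20.
rewrite leeBrDr; last exact/finc/subsetUr.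
(* Contents grow as the scale shrinks, so one scale e serves both sets; the half-gap ensures e < b -
   a. *)
pose e : R := Num.min (Num.min d1 d2) ((b - a) / 2)%R.
have e0 : (0 < e)%R by rewrite !lt_min d10 d20 /=; lra.
have eba : (e < b - a)%R.
  by rewrite gt_min; apply/orP; right; lra.
apply: (@le_trans _ _ (hausdorff_content s e A + hausdorff_content s e B)).
  by apply: leeD; apply: hausdorff_content_antimono; rewrite /e !ge_min lexx ?orbT.
apply: le_trans (hausdorff_content_le _ _ e0).
exact: hausdorff_content_separated lg eba Aa Bb.
Qed.

(* Caratheodory's criterion for the superlevel sets Y n = {g >= a + 1/(n+1)}
   and the layers L n = Y n.+1 \ Y n: as L n.+1 is at positive distance from
   Y n, h(L n.+1) <= h(Y n.+2) - h(Y n), and the sum over n telescopes. *)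
Lemma caratheodory_sublevel s (g : V -> R) (a : R) : lipschitz1 g ->
  (hausdorff s).-caratheodory [set x | (g x <= a)%R].
Proof.
move=> lg; apply: (@le_caratheodory_measurable R V (@hausdorff R d s)) => X /=.
have [->|] := eqVneq (hausdorff s X) +oo; first by rewrite leey.
rewrite -ltey => fX.
have fin C : C `<=` X -> hausdorff s C \is a fin_num.
  move=> CX; rewrite ge0_fin_numE ?hausdorff_ge0//.
  exact: le_lt_trans (le_hausdorff _ CX) fX.
pose Y n := X `&` [set x | (a + n.+1%:R^-1 <= g x)%R].
pose L n := X `&` [set x | (a + n.+2%:R^-1 <= g x < a + n.+1%:R^-1)%R].
pose y n := fine (hausdorff s (Y n)).
pose z n := fine (hausdorff s (L n)).
have inv_lt n : (n.+2%:R^-1 < n.+1%:R^-1 :> R)%R.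
  by rewrite ltf_pV2 ?posrE ?ltr0n// ltr_nat.
have yE n : hausdorff s (Y n) = (y n)%:E by rewrite fineK//; apply: fin => ? [].
have zE n : hausdorff s (L n) = (z n)%:E by rewrite fineK//; apply: fin => ? [].
have yz n : (z n.+1 + y n <= y n.+2)%R.
  rewrite -lee_fin EFinD -zE -(yE n) -(yE n.+2).
  apply: le_trans (_ : hausdorff s (L n.+1 `|` Y n) <= _).
    apply: (@hausdorff_separated s g (a + n.+2%:R^-1) (a + n.+1%:R^-1)%R) => //.
    - by rewrite ltrD2l.
    - by move=> x [_ /andP[_ /ltW]].
    - by move=> x [].
  apply: le_hausdorff => x [[Xx /= /andP[gx _]]|[Xx /= gx]]; split => //=.
  by rewrite (le_trans _ gx)// lerD2l lef_pV2 ?posrE ?ltr0n// ler_nat ltnS leqW.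
(* c is what remains for the part of X where g > a. It bounds every y n, because Y n is separated
   from the sublevel set. *)
set c := (fine (hausdorff s X) -
  fine (hausdorff s (X `&` [set x | (g x <= a)%R])))%R.
have yc n : (y n <= c)%R.
  rewrite /c lerBrDl -lee_fin EFinD -(yE n) !fineK; [|exact: fin|by apply: fin => ? []].
  apply: le_trans (_ : hausdorff s ((X `&` [set x | (g x <= a)%R]) `|` Y n) <= _).
    apply: (@hausdorff_separated s g a (a + n.+1%:R^-1)%R) => //.
    - by rewrite ltrDl invr_gt0 ltr0n.
    - by move=> x [].
    - by move=> x [].
  by apply: le_hausdorff => x [[]|[]].
pose M := sup (range y).
have My n : (y n <= M)%R.
  by apply: ub_le_sup; [exists c => _ [k _ <-]; exact: yc|exists n].
have Mle b : (forall k, y k <= b)%R -> (M <= b)%R.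
  by move=> yb; apply: ge_sup; [exists (y 0%N); exists 0%N|move=> _ [k _ <-]].
have h k : hausdorff s (X `&` ~` [set x | (g x <= a)%R]) <= (M + M - y k)%:E.
  (* Y (k+1) and the layers from index k + 1 on cover the part of X where g > a. *)
  pose F i := if i is j.+1 then L (k.+1 + j)%N else Y k.+1.
  apply: le_trans (_ : hausdorff s (\bigcup_i F i) <= _).
    apply: le_hausdorff => x [Xx /= /negP]; rewrite -ltNge => agx.
    have [ygx|ygx] := leP (a + k.+2%:R^-1)%R (g x); first by exists 0%N.
    have [n ngx] : exists n, (a + n.+1%:R^-1 <= g x)%R.
      have /ltr_add_invr[n] := agx.
      by move=> /ltW; exists n.
    (* Descend to the least n with a + 1/(n+1) <= g x, which locates the layer of x. *)
    elim: n ngx => [|n IH] ngx.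
      exfalso; move: ygx; apply/negP; rewrite -leNgt (le_trans _ ngx)//.
      by rewrite lerD2l lef_pV2 ?posrE ?ltr0n// ler_nat.
    have [/IH//|ngx'] := leP (a + n.+1%:R^-1)%R (g x).
    have kn : (k.+1 <= n)%N.
      rewrite leqNgt; apply/negP => nk.
      have : (g x < g x)%R; last by rewrite ltxx.
      apply: lt_le_trans ygx _; apply: le_trans ngx.
      by rewrite lerD2l lef_pV2 ?posrE ?ltr0n// ler_nat.
    by exists (n - k.+1).+1 => //=; rewrite subnKC//; split => //=; rewrite ngx.
  apply: le_trans (hausdorff_sigma_subadditive _ _) _.
  pose u i := hausdorff s (F i).
  have u0 : u 0%N = (y k.+1)%:E := yE _.
  have uS j : u j.+1 = (z (k.+1 + j)%N)%:E := zE _.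
  have u_ge0 j : 0 <= u j := hausdorff_ge0 _ _.
  rewrite -[X in X <= _]/(\sum_(0 <= i <oo) u i); clearbody u.
  apply: lime_le; first by apply: is_cvg_nneseries.
  (* The bound [yz] telescopes in steps of two, so two top terms remain, each at most M. *)
  have FN N : \sum_(0 <= i < N.+1) u i <= (y (k + N).+1 + y (k + N)%N - y k)%:E.
    elim: N => [|N IH].
      by rewrite big_nat1 addn0 u0 lee_fin addrK.
    rewrite big_nat_recr ?uS; last exact: leq0n.
    apply: (le_trans (leeD2r _ IH)); rewrite -EFinD lee_fin.
    by have := yz (k + N)%N; rewrite addSn addnS; lra.
  near=> N; have N0 : (0 < N)%N by near: N; exists 1%N.
  rewrite -(prednK N0); apply: le_trans (FN N.-1) _; rewrite lee_fin.
  by have := My (k + N.-1).+1; have := My (k + N.-1)%N; lra.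
have fT : hausdorff s (X `&` ~` [set x | (g x <= a)%R]) \is a fin_num.
  by apply: fin => ? [].
have fS : hausdorff s (X `&` [set x | (g x <= a)%R]) \is a fin_num.
  by apply: fin => ? [].
rewrite -(fineK fT) -(fineK (fin X (@subset_refl _ _))) -(fineK fS).
rewrite -EFinD lee_fin -lerBrDl -/c.
set u := fine _.
(* From u <= 2M - y k for all k, the supremum over k gives u <= M, and M <= c. *)
have : (M <= M + M - u)%R.
  by apply: Mle => k; rewrite lerBrDr -lerBrDl -lee_fin /u fineK.
by have := Mle _ yc; lra.
Unshelve. all: by end_near. Qed.

(** * Invariance of Hausdorff measure under isometric involutions *)

Section Isometry.
Variable phi : V -> V.
Hypotheses (phiK : involutive phi)
  (phi_isom : forall x y, enorm (phi x - phi y) = enorm (x - y)).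

(** Since phi is its own inverse, the inequality for preimages, used twice, gives equality;
    [hausdorff_isom] proceeds likewise after pulling back covers. *)
Lemma ediam_isom A : ediam (phi @^-1` A) = ediam A.
Proof.
have le B : ediam (phi @^-1` B) <= ediam B.
  apply: ge_ereal_sup => _ [x Bx] [y By] <-.
  by rewrite -phi_isom; exact: le_ediam.
apply/eqP; rewrite eq_le le /=.
have {1}-> : A = phi @^-1` (phi @^-1` A).
  by apply/seteqP; split => x /=; rewrite phiK.
exact: le.
Qed.

Lemma diam_pow_isom s A : diam_pow s (phi @^-1` A) = diam_pow s A.
Proof.
rewrite /diam_pow ediam_isom; congr (if _ then _ else _).
apply/eqP/eqP => [A0|->]; last exact: preimage_set0.
apply/seteqP; split => // x Ax.
by have : (phi @^-1` A) (phi x); [rewrite /= phiK|rewrite A0].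
Qed.

Lemma hausdorff_isom s A : hausdorff s (phi @^-1` A) = hausdorff s A.
Proof.
have le B : hausdorff s (phi @^-1` B) <= hausdorff s B.
  apply: hausdorff_leP => delta d0.
  apply: le_trans (hausdorff_content_le _ _ d0).
  apply: le_ereal_inf_tmp => _ [F [BF sF] <-].
  apply: ereal_inf_lbound; exists (fun i => phi @^-1` F i).
    split => [x /BF[i _ Fi]|i]; first by exists i.
    by rewrite ediam_isom.
  by apply: eq_eseriesr => i _; rewrite diam_pow_isom.
apply/eqP; rewrite eq_le le /=.
have {1}-> : A = phi @^-1` (phi @^-1` A).
  by apply/seteqP; split => x /=; rewrite phiK.
exact: le.
Qed.

Lemma measurable_isom s :
  @measurable_fun _ _ (hmeas_type d s) (hmeas_type d s) setT phi.
Proof.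
apply: (@measurability _ _ (hmeas_type d s) (hmeas_type d s) _ _
  (hausdorff s).-caratheodory) => // _ [A cA <-].
rewrite setTI; apply: sub_sigma_algebra => X.
rewrite -(hausdorff_isom s X) cA -[in RHS](hausdorff_isom s (X `&` _)).
rewrite -[in RHS](hausdorff_isom s (X `&` ~` _)).
by congr (_ + _); congr (hausdorff s _); apply/seteqP;
  split => x /=; rewrite phiK.
Qed.

End Isometry.

(** Open rays generate the Borel sets, and their preimages are complements of the sets in
    [caratheodory_sublevel]. This makes coordinates, hence polynomials, measurable. *)
Lemma measurable_lipschitz1 s (g : V -> R) : lipschitz1 g ->
  @measurable_fun _ _ (hmeas_type d s) R setT g.
Proof.
move=> lg; apply: (measurability _ (RGenOInfty.measurableE R)) => _ [_ [a ->] <-].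
rewrite setTI (_ : g @^-1` _ = ~` [set x | (g x <= a)%R]); last first.
  by apply/seteqP; split => x /=; rewrite in_itv/= andbT ltNge => /negP.
by apply: measurableC; apply: sub_sigma_algebra; exact: caratheodory_sublevel.
Qed.

End HausdorffOuterMeasure.

(** * Integration over the sphere *)

Section EuclideanGeometry.
Variables (R : realType) (d : nat).
Local Notation V := 'rV[R]_(d.+1).
Implicit Types (x y v w n : V) (a : R).

Lemma edotC x y : edot x y = edot y x.
Proof. by apply: eq_bigr => i _; rewrite mulrC. Qed.

Lemma edotDl x y v : edot (x + y) v = edot x v + edot y v.
Proof. by rewrite -big_split; apply: eq_bigr => i _; rewrite mxE mulrDl. Qed.

Lemma edotZl a x v : edot (a *: x) v = a * edot x v.
Proof. by rewrite mulr_sumr; apply: eq_bigr => i _; rewrite mxE mulrA. Qed.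

Lemma edotBl x y v : edot (x - y) v = edot x v - edot y v.
Proof. by rewrite -[- y]scaleN1r edotDl edotZl mulN1r. Qed.

Lemma edotBr x y v : edot v (x - y) = edot v x - edot v y.
Proof. by rewrite edotC edotBl !(edotC v). Qed.

Lemma edotDr x y v : edot v (x + y) = edot v x + edot v y.
Proof. by rewrite edotC edotDl !(edotC v). Qed.

Lemma edotZr a x v : edot v (a *: x) = a * edot v x.
Proof. by rewrite edotC edotZl (edotC v). Qed.

Lemma edot_ge0 x : 0 <= edot x x.
Proof. by apply: sumr_ge0 => i _; rewrite -expr2 sqr_ge0. Qed.

Lemma edot_eq0 x : edot x x = 0 -> x = 0.
Proof.
move=> /psumr_eq0P x0; apply/rowP => i; rewrite mxE.
have /eqP := x0 (fun i _ => sqr_ge0 (x 0 i)) i isT.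
by rewrite mulf_eq0 orbb => /eqP.
Qed.

Lemma edot_delta x i : edot x (delta_mx 0 i) = x 0 i.
Proof.
rewrite /edot (bigD1 i)//= mxE !eqxx mulr1 big1 ?addr0// => j ji.
by rewrite mxE (negbTE ji) mulr0.
Qed.

Lemma normr_coord_le x i : `|x 0 i| <= enorm x.
Proof.
rewrite -sqrtr_sqr ler_sqrt ?edot_ge0//.
rewrite /edot (bigD1 i)//= -expr2 lerDl.
by apply: sumr_ge0 => j _; rewrite -expr2 sqr_ge0.
Qed.

Lemma lipschitz1_coord i : lipschitz1 (fun x : V => x 0 i).
Proof. by move=> x y; have := normr_coord_le (x - y) i; rewrite !mxE. Qed.

Lemma sphereE x : sphere x <-> edot x x = 1.
Proof.
rewrite /sphere /= /enorm; split => [x1|->]; last exact: sqrtr1.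
by rewrite -(sqr_sqrtr (edot_ge0 x)) x1 expr1n.
Qed.

Lemma edot_sphere_le1 x y : sphere x -> sphere y -> edot x y <= 1.
Proof.
move=> /sphereE x1 /sphereE y1; have := edot_ge0 (x - y).
by rewrite edotBl !edotBr x1 y1 (edotC y x); lra.
Qed.

(* Reflection in the hyperplane orthogonal to n; the identity when n = 0,
   since division by 0 yields 0. *)
Definition reflection n x : V := x - (2 * edot x n / edot n n) *: n.

Lemma edot_reflection n x y : edot (reflection n x) y =
  edot x y - 2 * edot x n / edot n n * edot n y.
Proof. by rewrite /reflection edotBl edotZl. Qed.

Lemma reflection_isometry n x y :
  edot (reflection n x) (reflection n y) = edot x y.
Proof.
have [n0|n0] := eqVneq (edot n n) 0.
  by rewrite /reflection n0 invr0 !mulr0 !scale0r !subr0.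
rewrite edot_reflection /reflection !edotBr !edotZr (edotC n y).
by field.
Qed.

Lemma reflectionK n : involutive (reflection n).
Proof.
move=> x; have [n0|n0] := eqVneq (edot n n) 0.
  by rewrite /reflection n0 invr0 !mulr0 !scale0r !subr0.
rewrite {1}/reflection edot_reflection /reflection -addrA -opprD -scalerDl.
rewrite [X in X *: n](_ : _ = 0) ?scale0r ?subr0//.
by field.
Qed.

Lemma reflectionB n x y : reflection n x - reflection n y = reflection n (x - y).
Proof.
rewrite /reflection edotBl mulrBr mulrBl scalerBl.
by rewrite !opprD !opprK addrACA.
Qed.

(** Reflection in the bisecting hyperplane exchanges v and w and is self-adjoint. If v = w it is the
    identity. *)
Lemma reflection_swap v w x : edot v v = edot w w ->
  edot (reflection (v - w) x) v = edot x w.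
Proof.
move=> vw; rewrite edot_reflection edotBr.
have [n0|n0] := eqVneq (edot (v - w) (v - w)) 0.
  by rewrite n0 invr0 mulr0 mul0r subr0; move/edot_eq0/subr0_eq: n0 => ->.
have E : edot (v - w) (v - w) = 2 * edot (v - w) v.
  by rewrite !edotBl !edotBr vw (edotC w v); ring.
rewrite E in n0 *; field.
by move: n0; rewrite mulf_eq0 pnatr_eq0.
Qed.

Lemma reflection_sphere n : reflection n @^-1` (@sphere R d) = @sphere R d.
Proof.
by apply/seteqP; split => x /= /sphereE; rewrite ?reflection_isometry;
  move=> xE; apply/sphereE; rewrite ?reflection_isometry.
Qed.

End EuclideanGeometry.

Section PolynomialIdentity.
Variable R : numDomainType.
Implicit Type p : {poly R}.

(** A nonzero p - q cannot vanish at the size (p - q) distinct points 0, 1, 2, ... *)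
Lemma horner_ext p q : (forall x, p.[x] = q.[x]) -> p = q.
Proof.
move=> pq; apply/eqP; rewrite -subr_eq0; apply: contraT => pq0.
pose rs := [seq i%:R : R | i <- iota 0 (size (p - q))].
have /max_poly_roots : p - q != 0 by [].
move=> /(_ rs); rewrite size_map size_iota ltnn; apply.
  by apply/allP => x _; rewrite /root !hornerE pq subrr.
by rewrite map_inj_uniq ?iota_uniq// => i j /eqP; rewrite eqr_nat => /eqP.
Qed.

Lemma coef2_exp1Xsqr n : ((1 + 'X^2 : {poly R}) ^+ n)`_2 = n%:R.
Proof.
have [] // : ((1 + 'X^2 : {poly R}) ^+ n)`_0 = 1 /\
             ((1 + 'X^2 : {poly R}) ^+ n)`_2 = n%:R.
elim: n => [|n [IH0 IH2]]; first by rewrite expr0 !coef1.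
rewrite exprSr mulrDr mulr1 !coefD !coefMXn /= IH0 IH2 addr0.
by rewrite natr1.
Qed.

End PolynomialIdentity.

(** * Moments of linear forms on the sphere *)

Section HausdorffIntegral.
Variables (R : realType) (d : nat) (s : R).
Local Notation V := 'rV[R]_(d.+1).
Local Notation T := (@hmeas_type R d s).
Local Notation S := (@sphere R d).

Lemma measurable_coord i : @measurable_fun _ _ T R setT (fun x : V => x 0 i).
Proof. by apply: measurable_lipschitz1; exact: lipschitz1_coord. Qed.

Lemma measurable_edot (v : V) : @measurable_fun _ _ T R setT (fun x : V => edot x v).
Proof.
apply: measurable_sum => i; apply: measurable_funM; first exact: measurable_coord.
exact: measurable_cst.
Qed.

Lemma measurable_sphere : @measurable _ T S.
Proof.
have -> : S = setT `&` (fun x : V => edot x x) @^-1` [set 1].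
  by rewrite setTI; apply/seteqP; split => x /= /sphereE.
have mf : @measurable_fun _ _ T R setT (fun x : V => edot x x).
  by apply: measurable_sum => i; apply: measurable_funM; exact: measurable_coord.
by apply: mf => //; exact: measurable_set1.
Qed.

Lemma measurable_cap (x : V) r : @measurable _ T (cap x r).
Proof.
have -> : cap x r = S `&` (setT `&` (fun y : V => edot y x) @^-1` `[cos r, +oo[%classic).
  by rewrite setTI; apply/seteqP; split => y /=; rewrite in_itv/= andbT edotC.
apply: measurableI; first exact: measurable_sphere.
by apply: measurable_edot => //; exact: measurable_itv.
Qed.

Lemma measurable_horner_edot (p : {poly R}) (v : V) :
  @measurable_fun _ _ T R setT (fun x : V => p.[edot x v]).
Proof.
rewrite (_ : (fun x : V => p.[edot x v]) =
  fun x : V => \sum_(i < size p) p`_i * edot x v ^+ i); last first.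
  by apply/funext => x; rewrite horner_coef.
apply: measurable_sum => i; apply: measurable_funM; first exact: measurable_cst.
by apply: measurable_funX; exact: measurable_edot.
Qed.

(** Bounds are asked only on the sphere, so polynomials qualify; a sphere of finite measure makes
    these functions integrable. *)
Definition bounded_measurable (f : V -> R) :=
  @measurable_fun _ _ T R setT f /\ exists M, forall x, S x -> `|f x| <= M.

Lemma bounded_measurable_cst a : bounded_measurable (fun=> a).
Proof. by split; [exact: measurable_cst|exists `|a|]. Qed.

Lemma bounded_measurable_coord i : bounded_measurable (fun x => x 0 i).
Proof.
split; first exact: measurable_coord.
by exists 1 => x Sx; rewrite (le_trans (normr_coord_le _ _))// Sx.
Qed.

Lemma bounded_measurableD f g : bounded_measurable f -> bounded_measurable g ->
  bounded_measurable (fun x => f x + g x).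
Proof.
move=> [mf [M fM]] [mg [N gN]]; split; first exact: measurable_funD.
by exists (M + N) => x Sx; rewrite (le_trans (ler_normD _ _))// lerD ?fM ?gN.
Qed.

Lemma bounded_measurableM f g : bounded_measurable f -> bounded_measurable g ->
  bounded_measurable (fun x => f x * g x).
Proof.
move=> [mf [M fM]] [mg [N gN]]; split; first exact: measurable_funM.
by exists (M * N) => x Sx; rewrite normrM ler_pM ?fM ?gN.
Qed.

Lemma bounded_measurableX f n : bounded_measurable f ->
  bounded_measurable (fun x => f x ^+ n).
Proof.
move=> bf; elim: n => [|n IH]; first exact: bounded_measurable_cst.
by under eq_fun do rewrite exprS; exact: bounded_measurableM.
Qed.

Lemma bounded_measurable_sum (I : Type) (r : seq I) (P : pred I) (f : I -> V -> R) :
  (forall i, bounded_measurable (f i)) ->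
  bounded_measurable (fun x => \sum_(i <- r | P i) f i x).
Proof.
move=> bf; elim: r => [|i r IH].
  by under eq_fun do rewrite big_nil; exact: bounded_measurable_cst.
under eq_fun do rewrite big_cons.
by case: (P i) => //; exact: bounded_measurableD.
Qed.

Lemma bounded_measurable_edot v : bounded_measurable (fun x => edot x v).
Proof.
apply: bounded_measurable_sum => i.
apply: bounded_measurableM; first exact: bounded_measurable_coord.
exact: bounded_measurable_cst.
Qed.

Lemma bounded_measurable_horner (p : {poly R}) v :
  bounded_measurable (fun x => p.[edot x v]).
Proof.
under eq_fun do rewrite horner_coef.
apply: bounded_measurable_sum => i.
apply: bounded_measurableM; first exact: bounded_measurable_cst.
exact/bounded_measurableX/bounded_measurable_edot.
Qed.

Variable mu : {measure set T -> \bar R}.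
Hypothesis muE : forall B, measurable B -> mu B = hausdorff s B.
Hypothesis S_fin : (hausdorff s S < +oo)%E.

Definition sphere_int (f : V -> R) : R := \int[mu]_(x in S) f x.

Lemma sphere_integrable f : bounded_measurable f ->
  mu.-integrable S (EFin \o f).
Proof.
move=> [mf [M fM]]; apply: measurable_bounded_integrable.
- exact: measurable_sphere.
- by rewrite muE//; exact: measurable_sphere.
- by apply: measurable_funTS.
- by exists M; split=> [|N MN x Sx]; [exact: num_real|exact: le_trans (fM _ Sx) (ltW MN)].
Qed.

Lemma eq_sphere_int f g : (forall x, S x -> f x = g x) -> sphere_int f = sphere_int g.
Proof. by move=> fg; apply: eq_Rintegral => x /[!inE]; exact: fg. Qed.

Lemma sphere_intD f g : bounded_measurable f -> bounded_measurable g ->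
  sphere_int (fun x => f x + g x) = sphere_int f + sphere_int g.
Proof.
move=> bf bg; apply: RintegralD; first exact: measurable_sphere.
  exact: sphere_integrable.
exact: sphere_integrable.
Qed.

Lemma sphere_intZ a f : bounded_measurable f ->
  sphere_int (fun x => a * f x) = a * sphere_int f.
Proof.
move=> bf; apply: RintegralZl; first exact: measurable_sphere.
exact: sphere_integrable.
Qed.

Lemma sphere_int_sum (I : Type) (r : seq I) (P : pred I) (f : I -> V -> R) :
  (forall i, bounded_measurable (f i)) ->
  sphere_int (fun x => \sum_(i <- r | P i) f i x) =
  \sum_(i <- r | P i) sphere_int (f i).
Proof.
move=> bf; elim: r => [|i r IH].
  rewrite big_nil (@eq_sphere_int _ (fun x => 0 * 0)).
    rewrite (@sphere_intZ 0 (fun=> 0)) ?mul0r//; exact: bounded_measurable_cst.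
  by move=> x _; rewrite big_nil mul0r.
rewrite big_cons -IH; under eq_sphere_int do rewrite big_cons.
by case: (P i) => //; rewrite sphere_intD//; exact: bounded_measurable_sum.
Qed.

(** Change of variables: the pushforward of mu by an isometric reflection agrees with mu on
    measurable sets, and the sphere is its own preimage. *)
Lemma sphere_int_reflection n f : bounded_measurable f ->
  sphere_int (fun x => f (reflection n x)) = sphere_int f.
Proof.
move=> bf; have isom x y : enorm (reflection n x - reflection n y) = enorm (x - y).
  by rewrite /enorm reflectionB reflection_isometry.
have mphi : @measurable_fun _ _ T T setT (reflection n).
  by apply: measurable_isom => //; exact: reflectionK.
rewrite /sphere_int /Rintegral; congr fine.
pose phi : {mfun T >-> T} := mfun_Sub (mem_set mphi).
transitivity (\int[pushforward mu phi]_(x in S) (f x)%:E)%E.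
  rewrite (@integral_pushforward _ _ T T R phi mphi mu S (EFin \o f)).
  - by rewrite reflection_sphere.
  - by apply/measurable_EFinP; exact: bf.1.
  - rewrite reflection_sphere; apply: sphere_integrable (f \o reflection n) _.
    split; first exact: (measurableT_comp bf.1 mphi).
    have [M fM] := bf.2; exists M => x Sx; apply: fM.
    by rewrite -(reflection_sphere n) in Sx.
  - exact: measurable_sphere.
apply: eq_measure_integral => A mA _.
have mphiA : @measurable _ T (reflection n @^-1` A).
  by rewrite -[X in measurable X]setTI; apply: (mphi).
transitivity (mu (reflection n @^-1` A)) => //; rewrite !muE//.
exact: (hausdorff_isom (@reflectionK _ _ n) isom).
Qed.

Definition moment (v : V) k : R := sphere_int (fun x => edot x v ^+ k).

Let bmX v k : bounded_measurable (fun x => edot x v ^+ k).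
Proof. exact/bounded_measurableX/bounded_measurable_edot. Qed.

Let bmcX i k : bounded_measurable (fun x => x 0 i ^+ k).
Proof. exact/bounded_measurableX/bounded_measurable_coord. Qed.

Lemma moment_norm v w k : edot v v = edot w w -> moment v k = moment w k.
Proof.
move=> vw; rewrite /moment -(sphere_int_reflection (v - w))//.
by apply: eq_sphere_int => x _; rewrite reflection_swap.
Qed.

Lemma momentZ a v k : moment (a *: v) k = a ^+ k * moment v k.
Proof.
rewrite /moment -sphere_intZ//; apply: eq_sphere_int => x _.
by rewrite edotZr exprMn.
Qed.

(** v and -v have equal length, so an odd moment equals its opposite. *)
Lemma moment_odd v k : odd k -> moment v k = 0.
Proof.
move=> ok; have := momentZ (-1) v k; rewrite -signr_odd ok expr1 mulN1r.
rewrite -(@moment_norm v); last by rewrite edotZl edotZr !mulN1r opprK.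
lra.
Qed.

Local Notation e0 := (delta_mx 0 ord0 : V).

Let e0_unit : edot e0 e0 = 1. Proof. by rewrite edot_delta mxE eqxx. Qed.

(* Coefficient of a^2 in the identity
   int (x_0 + a x_j)^(2m+2) = (1 + a^2)^(m+1) int x_0^(2m+2). *)
Lemma mixed_moment j m : j != ord0 ->
  m.*2.+1%:R * sphere_int (fun x => x 0 ord0 ^+ m.*2 * x 0 j ^+ 2) =
  moment e0 m.*2.+2.
Proof.
move=> j0; set n := m.*2.+2.
pose c l := sphere_int (fun x => x 0 ord0 ^+ (n - l) * x 0 j ^+ l).
(* At each a both sides are the moment of e_0 + a e_j: by the binomial theorem on the left, by |e_0
   + a e_j|^2 = 1 + a^2 on the right. *)
have pE : \sum_(l < n.+1) ('C(n, l)%:R * c l) *: 'X^l =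
    moment e0 n *: (1 + 'X^2) ^+ m.+1 :> {poly R}.
  apply: horner_ext => a; transitivity (moment (e0 + a *: delta_mx 0 j) n).
    rewrite horner_sum /moment.
    transitivity (\sum_(l < n.+1) sphere_int (fun x : V =>
        ('C(n, l)%:R * a ^+ l) * (x 0 ord0 ^+ (n - l) * x 0 j ^+ l))).
      apply: eq_bigr => l _; rewrite sphere_intZ; last exact: bounded_measurableM.
      by rewrite hornerZ hornerXn -/(c l) mulrAC.
    rewrite -sphere_int_sum => [|l]; last first.
      apply: bounded_measurableM; first exact: bounded_measurable_cst.
      exact: bounded_measurableM.
    apply: eq_sphere_int => x _.
    rewrite edotDr edotZr !edot_delta exprDn; apply: eq_bigr => l _.
    by rewrite -mulr_natl exprMn; ring.
  rewrite (@moment_norm _ (Num.sqrt (1 + a ^+ 2) *: e0)).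
    rewrite momentZ hornerZ horner_exp hornerD hornerXn hornerC mulrC.
    rewrite /n -doubleS -mul2n exprM sqr_sqrtr//.
    by rewrite addr_ge0// sqr_ge0.
  rewrite edotZl edotZr e0_unit mulr1 -expr2 sqr_sqrtr ?addr_ge0 ?sqr_ge0//.
  rewrite edotDl !edotDr !edotZl !edotZr !edot_delta !mxE !eqxx /=.
  by rewrite [ord0 == j]eq_sym (negbTE j0) !mulr0 !mulr1 addr0 add0r expr2.
have := congr1 (fun p : {poly R} => p`_2) pE.
rewrite coefZ coef2_exp1Xsqr coef_sum.
rewrite (bigD1 (inord 2))//= inordK// big1 ?addr0; last first.
  move=> l l2; rewrite coefZ coefXn.
  suff -> : (2%N == l) = false by rewrite mulr0.
  apply/negbTE; apply: contraNneq l2 => l2; apply/eqP/val_inj.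
  by rewrite /= inordK.
rewrite coefZ coefXn eqxx mulr1 /c /n !subSS subn0.
(* The factor m + 1 also appears on the right, as the coefficient of a^2 in (1 + a^2)^(m+1), and
   cancels. *)
have -> : 'C(m.*2.+2, 2)%:R = m.+1%:R * m.*2.+1%:R :> R.
  by rewrite bin2 -natrM -[X in (X * _)./2]/(m.+1.*2) -doubleMl doubleK.
move=> H; have m0 : m.+1%:R != 0 :> R by rewrite pnatr_eq0.
by apply: (mulfI m0); rewrite mulrA H mulrC.
Qed.

(** Odd moments vanish. For k = 2m take v = e_0, integrate x_0^(2m) (1 - x_0^2) = sum over j != 0 of
    x_0^(2m) x_j^2, and apply [mixed_moment] to each of the d terms. *)
Lemma moment_rec v k : edot v v = 1 ->
  k.+1%:R * (moment v k - moment v k.+2) = d%:R * moment v k.+2.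
Proof.
move=> v1; have [ok|ek] := boolP (odd k).
  by rewrite !moment_odd//= ?negbK// subrr !mulr0.
rewrite !(@moment_norm v e0) ?v1 ?e0_unit//.
have kE : k = k./2.*2 by rewrite even_halfK.
rewrite kE; move: k./2 => {kE ek}m.
have -> : d%:R * moment e0 m.*2.+2 = \sum_(j < d.+1 | j != ord0) moment e0 m.*2.+2.
  by rewrite sumr_const cardC1 card_ord /= mulr_natl.
under eq_bigr => j j0 do rewrite -(mixed_moment m j0).
rewrite -mulr_sumr -sphere_int_sum => [|j]; last exact: bounded_measurableM.
congr (_ * _); apply/eqP; rewrite subr_eq; apply/eqP.
rewrite /moment -sphere_intD//; last first.
  by apply: bounded_measurable_sum => j; exact: bounded_measurableM.
apply: eq_sphere_int => x /sphereE x1; rewrite !edot_delta.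
move: x1; rewrite /edot (bigD1 ord0)//= => x1.
rewrite -mulr_sumr -[m.*2.+2]addn2 exprD -mulrDr.
by rewrite -[LHS]mulr1; congr (_ * _); rewrite -x1 addrC expr2; congr (_ + _).
Qed.

Variables (t : nat) (v : V).
Hypotheses (d0 : (0 < d)%N) (t0 : (0 < t)%N) (v1 : sphere v).
Hypothesis S_pos : (0 < hausdorff s S)%E.

Lemma sphere_int_jacobi_sqr :
  sphere_int (fun x => (jacobi R d t).[edot x v] ^+ 2) / fine (hausdorff s S)
  = (dimPi d t)%:R^-1.
Proof.
have S0 : fine (hausdorff s S) != 0.
  by rewrite gt_eqF// fine_gt0// S_pos S_fin.
pose L (p : {poly R}) := sphere_int (fun x => p.[edot x v]) / fine (hausdorff s S).
have bm p := bounded_measurable_horner p v.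
rewrite -(@functional_jacobi_sqr R d t d0 t0 L).
- by congr (_ / _); apply: eq_sphere_int => x _; rewrite horner_exp.
- move=> p q; rewrite /L -mulrDl -sphere_intD//; congr (_ / _).
  by apply: eq_sphere_int => x _; rewrite hornerD.
- move=> a p; rewrite /L mulrA -sphere_intZ//; congr (_ / _).
  by apply: eq_sphere_int => x _; rewrite hornerZ.
- rewrite /L /sphere_int; under eq_Rintegral do rewrite hornerC.
  rewrite Rintegral_cst; last exact: measurable_sphere.
  by rewrite mul1r muE ?divff//; exact: measurable_sphere.
- rewrite /L (@eq_sphere_int _ (fun x => edot x v ^+ 1)); last first.
    by move=> x _; rewrite hornerX.
  by rewrite -/(moment v 1) moment_odd// mul0r.
- have E k : L 'X^k = moment v k / fine (hausdorff s S).
    by congr (_ / _); apply: eq_sphere_int => x _; rewrite hornerXn.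
  move=> k; rewrite !E -mulrBl !mulrA moment_rec//.
  exact/sphereE.
Qed.

End HausdorffIntegral.

(** * Zonal polynomials on caps *)

Section SphericalPolynomials.
Variables (R : realType) (d t : nat).
Local Notation V := 'rV[R]_(d.+1).
Implicit Types f g : V -> R.

Lemma is_poly_deg_monomial (e : 'I_d.+1 -> nat) : (\sum_i e i <= t)%N ->
  is_poly_deg t (fun x : V => \prod_(i < d.+1) x 0 i ^+ e i).
Proof.
move=> et; pose a0 : {ffun 'I_d.+1 -> 'I_t.+1} := [ffun i => inord (e i)].
have a0E i : a0 i = e i :> nat.
  by rewrite ffunE inordK// ltnS (leq_trans _ et)// (bigD1 i)//= leq_addr.
exists (fun a => (a == a0)%:R) => x _.
rewrite (bigD1 a0)/=; last by under eq_bigr do rewrite a0E.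
rewrite eqxx mul1r [X in _ + X]big1; last by move=> a /andP[_ /negbTE ->]; rewrite mul0r.
by rewrite addr0; apply: eq_bigr => i _; rewrite a0E.
Qed.

Lemma is_poly_degZ c f : is_poly_deg t f -> is_poly_deg t (fun x => c * f x).
Proof.
move=> [a aE]; exists (fun i => c * a i) => x Sx.
by rewrite aE// mulr_sumr; apply: eq_bigr => i _; rewrite mulrA.
Qed.

Lemma is_poly_deg_sum (I : Type) (r : seq I) (F : I -> V -> R) :
  (forall i, is_poly_deg t (F i)) -> is_poly_deg t (fun x => \sum_(i <- r) F i x).
Proof.
move=> /choice[c cE]; exists (fun a => \sum_(i <- r) c i a) => x Sx.
under eq_bigr do rewrite cE//.
by rewrite exchange_big; apply: eq_bigr => a _; rewrite mulr_suml.
Qed.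

Lemma is_poly_deg_edotX (v : V) k : (k <= t)%N ->
  is_poly_deg t (fun x => edot x v ^+ k).
Proof.
move=> kt.
(* Expand the power over all maps g choosing a coordinate for each factor; x_i then occurs as often
   as g takes the value i, which gives total degree k. *)
have -> : (fun x : V => edot x v ^+ k) = fun x =>
    \sum_(g : {ffun 'I_k -> 'I_d.+1}) (\prod_j v 0 (g j)) *
      \prod_(i < d.+1) x 0 i ^+ #|[pred j | g j == i]|.
  apply/funext => x; rewrite -[k in LHS]card_ord -prodr_const bigA_distr_bigA /=.
  apply: eq_bigr => g _; rewrite big_split /= mulrC; congr (_ * _).
  rewrite (partition_big g predT)//=; apply: eq_bigr => i _.
  by rewrite -prodr_const; apply: eq_bigr => j /eqP ->.
apply: is_poly_deg_sum => g; apply: is_poly_degZ; apply: is_poly_deg_monomial.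
rewrite (leq_trans _ kt)// -[leqRHS]card_ord -[leqRHS]sum1_card.
rewrite [leqRHS](partition_big g predT)//=; apply: leq_sum => i _.
by rewrite -sum1_card.
Qed.

Lemma is_poly_deg_horner (p : {poly R}) (v : V) : (size p <= t.+1)%N ->
  is_poly_deg t (fun x => p.[edot x v]).
Proof.
move=> sp; under eq_fun do rewrite (horner_coef_wide _ sp).
apply: is_poly_deg_sum => i; apply: is_poly_degZ; apply: is_poly_deg_edotX.
by rewrite -ltnS.
Qed.

End SphericalPolynomials.

(** * Lower bound for the Jacobi polynomial on the cap *)

Section KernelOnCap.
Variable R : realType.

Lemma sin_le (x : R) : 0 <= x -> `|sin x| <= x.
Proof.
move=> x0.
have sinc : {within `[0, x], continuous (@sin R)}.
  by apply: continuous_subspaceT; exact: continuous_sin.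
have [c _] := MVT_segment x0 (fun y _ => is_derive_sin y) sinc.
rewrite sin0 !subr0 => ->; rewrite normrM (ger0_norm x0) ler_piMl//.
exact: cos_max.
Qed.

Lemma cos_ge (x : R) : 0 <= x -> 1 - x ^+ 2 / 2 <= cos x.
Proof.
move=> x0; have -> : x = (x / 2) *+ 2 by rewrite -mulr_natr divfK// pnatr_eq0.
rewrite cos_mulr2n cos2sin2 -mulr_natr.
have x20 : 0 <= x / 2 by rewrite divr_ge0.
have : sin (x / 2) ^+ 2 <= (x / 2) ^+ 2.
  by rewrite -real_normK ?num_real// lerXn2r ?nnegrE// sin_le.
rewrite -[_ *+ 2]mulr_natr; lra.
Qed.

Lemma jacobi_cap_ge (d t : nat) (nu r : R) (x y : 'rV[R]_d.+1) :
  (0 < d)%N -> (0 < t)%N -> 0 < nu < 1 -> 0 < r ->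
  r ^+ 2 = (1 - nu) * ((d%:R + 2) / (t%:R * (t%:R + d%:R))) ->
  sphere x -> cap x r y -> nu <= (jacobi R d t).[edot y x].
Proof.
move=> d0 t0 /andP[nu0 nu1] r0 r2 Sx [Sy xy].
have dR : 0 < d%:R :> R by rewrite ltr0n.
have tR : 0 < t%:R :> R by rewrite ltr0n.
pose m : R := t%:R * (t%:R + d%:R).
have m0 : 0 < m by rewrite mulr_gt0// addr_gt0.
have rm : r ^+ 2 * m = (1 - nu) * (d%:R + 2).
  by rewrite r2 -/m -mulrA divfK// gt_eqF.
rewrite horner_jacobi; set z := (1 - _) / 2.
have z0 : 0 <= z.
  by rewrite divr_ge0// subr_ge0 edot_sphere_le1.
(* From x.y >= cos r >= 1 - r^2/2. With c = (d + 2)/2, the choice of r gives z t(t + d)/c <= (1 -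
   nu)/2, and 1 - (1 - nu)/2 >= nu. *)
have zr : z <= r ^+ 2 / 4.
  by rewrite /z edotC; have := cos_ge (ltW r0); lra.
have zm : z * m <= (1 - nu) * (d%:R + 2) / 4.
  by rewrite -rm [leRHS]mulrAC; apply: ler_wpM2r => //; exact: ltW.
have c0 : 0 < d%:R / 2 + 1 :> R by rewrite addr_gt0// divr_gt0.
have zc : z * m <= d%:R / 2 + 1 by nra.
apply: le_trans (jacobi_ge d0 z0 zc).
rewrite -/m lerBrDl -lerBrDr ler_pdivrMr//; nra.
Qed.

End KernelOnCap.

Lemma weighted_cap_integral_ge (R : realType) (d : nat) (s : R)
  (mu : {measure set (@hmeas_type R d s) -> \bar R})
  (X : set 'rV[R]_(d.+1)) (w f : 'rV[R]_(d.+1) -> R) (C : set 'rV[R]_(d.+1)) (nu : R) :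
  @measurable _ (@hmeas_type R d s) X -> @measurable _ (@hmeas_type R d s) C ->
  (forall x, X x -> 0 <= w x) ->
  mu.-integrable X (fun x => (w x)%:E) ->
  @measurable_fun _ _ (@hmeas_type R d s) R setT f -> 0 <= nu ->
  (forall x, X x -> C x -> nu <= f x) ->
  ((nu ^+ 2)%:E * \int[mu]_(x in X `&` C) (w x)%:E <=
   \int[mu]_(x in X) ((f x) ^+ 2 * w x)%:E)%E.
Proof.
move=> mX mC w0 iw mf nu0 fC.
have mw : @measurable_fun _ _ (@hmeas_type R d s) R X w.
  by apply/measurable_EFinP; exact: measurable_int iw.
have mXC : @measurable _ (@hmeas_type R d s) (X `&` C) by exact: measurableI.
have mwC : @measurable_fun _ _ (@hmeas_type R d s) R (X `&` C) w.
  by apply: measurable_funS mw => // x [].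
have mfw : @measurable_fun _ _ (@hmeas_type R d s) R X (fun x => f x ^+ 2 * w x).
  by apply: measurable_funM => //; apply: measurable_funX; exact: measurable_funTS.
rewrite -ge0_integralZl_EFin//; last 3 first.
- by move=> x [Xx _]; rewrite lee_fin w0.
- exact/measurable_EFinP.
- by rewrite sqr_ge0.
apply: (@le_trans _ _ (\int[mu]_(x in X `&` C) (f x ^+ 2 * w x)%:E)%E).
  apply: ge0_le_integral => //.
  - by move=> x [Xx _]; rewrite mule_ge0// lee_fin ?sqr_ge0// w0.
  - by apply: measurable_funeM; exact/measurable_EFinP.
  - by apply/measurable_EFinP; apply: measurable_funS mfw => // x [].
  - move=> x [Xx Cx]; rewrite -EFinM lee_fin ler_wpM2r ?w0//.
    by rewrite lerXn2r ?nnegrE ?fC// (le_trans nu0)// fC.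
apply: ge0_subset_integral => //.
- exact/measurable_EFinP.
- by move=> x Xx; rewrite lee_fin mulr_ge0 ?sqr_ge0// w0.
Qed.

Unset Implicit Arguments.

Theorem theorem6p2 (R : realType) (d t : nat) (s : R)
  (mus : {measure set (@hmeas_type R d s) -> \bar R})
  (mud : {measure set (@hmeas_type R d d%:R) -> \bar R})
  (X : set 'rV[R]_(d.+1)) (w : 'rV[R]_(d.+1) -> R) (A : R)
  (xt : 'rV[R]_(d.+1)) (nu q r : R) :
  (1 <= d)%N -> (1 <= t)%N -> 0 <= s <= d%:R ->
  (* mus, mud are the Hausdorff measures h_s, h_d on their measurable sets *)
  (forall B, measurable B -> mus B = hausdorff s B) ->
  (forall B, measurable B -> mud B = hausdorff d%:R B) ->
  X `<=` @sphere R d ->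
  @measurable _ (@hmeas_type R d s) X ->
  (0 < hausdorff s X)%E -> (hausdorff s X < +oo)%E ->
  (forall x, X x -> 0 <= w x) ->
  mus.-integrable X (fun x => (w x)%:E) ->
  (* upper Marcinkiewicz-Zygmund inequality of order t *)
  (forall f : 'rV[R]_(d.+1) -> R, is_poly_deg t f ->
     ((fine (hausdorff s X))^-1%:E *
        \int[mus]_(x in X) ((f x) ^+ 2 * w x)%:E
      <= A%:E * ((fine (hausdorff d%:R (@sphere R d)))^-1%:E *
        \int[mud]_(x in @sphere R d) ((f x) ^+ 2)%:E))%E) ->
  X xt -> 0 < nu < 1 -> 0 < q -> 0 < r ->
  r ^+ 2 = (1 - nu) * ((d%:R + 2) / (t%:R * (t%:R + d%:R))) ->
  (\int[mus]_(x in X `&` cap xt r) (w x)%:E >= (q * r `^ s)%:E)%E ->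
  (hausdorff s X >=
     ((q * nu ^+ 2 / A * ((1 - nu) / (1 + d%:R / t%:R) * (d%:R + 2)) `^ (s / 2))
       * (dimPi d t)%:R / (t%:R `^ s))%:E)%E.
Proof.
move=> d1 t1 /andP[s0 sd] musE mudE XS mX hX0 hXoo w0 iw MZ Xxt nu01 q0 r0 r2 capq.
have Sxt := XS _ Xxt; have /andP[nu0 nu1] := nu01.
(* For A <= 0 the claimed bound is at most 0, with 1/0 = 0 when A = 0. *)
have [A0|A0] := leP A 0.
  apply: le_trans (hausdorff_ge0 s X); rewrite lee_fin.
  do 3 (apply: mulr_le0_ge0; last by rewrite ?invr_ge0 ?powR_ge0).
  by rewrite mulr_ge0_le0 ?invr_le0// mulr_ge0 ?sqr_ge0// ltW.
pose J := jacobi R d t; pose f x := J.[edot x xt].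
have fdeg : is_poly_deg t f by apply: is_poly_deg_horner; exact: size_jacobi.
have mf : @measurable_fun _ _ (@hmeas_type R d s) R setT f.
  exact: measurable_horner_edot.
have fcap x : X x -> cap xt r x -> nu <= f x.
  by move=> _; apply: jacobi_cap_ge nu01 r0 r2 Sxt.
have low := weighted_cap_integral_ge mX (measurable_cap xt r) w0 iw mf (ltW nu0) fcap.
set H := fine (hausdorff s X).
have HE : hausdorff s X = H%:E.
  by rewrite fineK// ge0_fin_numE// ltW.
have H0 : 0 < H by rewrite -lte_fin -HE.
have rs0 : 0 < r `^ s by rewrite powR_gt0.
have lowH : ((H^-1 * (nu ^+ 2 * (q * r `^ s)))%:E <=
    H^-1%:E * \int[mus]_(x in X) (f x ^+ 2 * w x)%:E)%E.
  rewrite EFinM lee_wpmul2l ?lee_fin ?invr_ge0 ?(ltW H0)//.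
  apply: le_trans low; rewrite EFinM lee_wpmul2l ?lee_fin ?sqr_ge0//.
have {MZ lowH low} main := le_trans lowH (MZ _ fdeg).
have pos : 0 < H^-1 * (nu ^+ 2 * (q * r `^ s)).
  by rewrite !mulr_gt0 ?invr_gt0// exprn_gt0.
have dim0 : 0 < (dimPi d t)%:R :> R.
  by rewrite ltr0n addn_gt0 bin_gt0 leq_addl.
have key : H^-1 * (nu ^+ 2 * (q * r `^ s)) <= A / (dimPi d t)%:R.
  (* If h_d of the sphere were 0 or +oo, its [fine] and the inverse of that would be 0, and [main]
     would contradict [pos]. *)
  have [hS0|hS0] := eqVneq (fine (hausdorff d%:R (@sphere R d))) 0.
    move: main; rewrite hS0 invr0 mul0e mule0 lee_fin => /(lt_le_trans pos).
    by rewrite ltxx.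
  have hSoo : (hausdorff d%:R (@sphere R d) < +oo)%E.
    by rewrite ltey; apply: contra_neq hS0 => ->.
  have hSpos : (0 < hausdorff d%:R (@sphere R d))%E.
    by rewrite lt_neqAle hausdorff_ge0 andbT eq_sym; apply: contra_neq hS0 => ->.
  have bf : bounded_measurable d%:R (fun x => f x ^+ 2).
    exact/bounded_measurableX/bounded_measurable_horner.
  have := sphere_int_jacobi_sqr mudE hSoo d1 t1 Sxt hSpos.
  rewrite -lee_fin; move: main.
  rewrite -[(\int[mud]_(x in _) _)%E]fineK; last first.
    by apply: integrable_fin_num; [exact: measurable_sphere|exact: sphere_integrable].
  by rewrite -!EFinM => main jE; rewrite -jE [_ / fine _]mulrC.
rewrite HE lee_fin.
have d0R : 0 < d%:R :> R by rewrite ltr0n.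
have t0R : 0 < t%:R :> R by rewrite ltr0n.
(* The power in the constant is thus (r t)^s: its t^s cancels the denominator, and r^s is the one in
   the cap hypothesis. *)
have -> : (1 - nu) / (1 + d%:R / t%:R) * (d%:R + 2) = (r * t%:R) ^+ 2.
  rewrite exprMn r2; field.
  by rewrite !gt_eqF// ?addr_gt0.
have -> : ((r * t%:R) ^+ 2) `^ (s / 2) = r `^ s * t%:R `^ s.
  rewrite -powRM ?ltW// -powR_mulrn ?mulr_ge0 ?ltW// -powRrM.
  by congr (_ `^ _); rewrite mulrC divfK// pnatr_eq0.
have ts0 : 0 < t%:R `^ s :> R by rewrite powR_gt0.
have -> : q * nu ^+ 2 / A * (r `^ s * t%:R `^ s) * (dimPi d t)%:R / t%:R `^ s =
    nu ^+ 2 * (q * r `^ s) * (dimPi d t)%:R / A by field; rewrite !gt_eqF.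
by rewrite ler_pdivrMr//; move: key; rewrite ler_pdivrMl// [leRHS]mulrA ler_pdivlMr.
Qed.
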